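(* Let $k\ge 2$ be an integer and let $p\equiv 1\pmod k$ be a prime with $p>217^2k^4$. Let $D_k=\{x^k : x\in\mathbb{F}_p\setminus\{0\}\}$. Then $$D_k\neq A+B+C$$ for all $A,B,C\subseteq\mathbb{F}_p$ with $|A|,|B|,|C|\ge 2$.
   Context: For a prime $p$, $\mathbb{F}_p$ is the field with $p$ elements. For $A,B,C\subseteq\mathbb{F}_p$, $A+B+C=\{a+b+c: a\in A,\ b\in B,\ c\in C\}$, and $|A|$ denotes the cardinality of $A$. $D_k$ is the set of nonzero $k$th powers in $\mathbb{F}_p$. *)

(* Defs.v *)
From mathcomp Require Import all_boot all_order all_algebra.

Set Implicit Arguments.
Unset Strict Implicit.
Unset Printing Implicit Defensive.

Import GRing.Theory.
Local Open Scope ring_scope.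

Definition sumset (V : finZmodType) (A B : {set V}) : {set V} :=
  [set a + b | a in A, b in B].

(* ['F_p] is the field with p elements only for prime p. *)
Definition kth_powers (p k : nat) : {set 'F_p} :=
  [set x ^+ k | x : 'F_p & x != 0].

(* Main.v *)
Require Import Defs.
From mathcomp Require Import all_boot all_order all_algebra.
From mathcomp Require Import finfield ring zify.

(**
Write [d = (p - 1) / k] and suppose [D_k = A + S] with [n = #|A|]; replace [A] by
[-A], so that [(s - a) ^ d = 1] for all [a] in [A] and [s] in [S].  Let [c_a] be
the Lagrange weights of [A].  As in Hanson and Petridis, Stepanov's polynomial
[f = \sum_a c_a (X - a) ^ (n - 1 + d) - (-1) ^ (n - 1)] has degree [d] and vanishes
to order [n] on [S], so [n #|S| <= d]; as [D_k] has [d] elements, equality holds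
and [f] is proportional to [P ^ n], where [P] is the monic polynomial with simple
roots [S].  Comparing the Taylor coefficients of order [n], [n + 1] and [n + 2]
of [f] and [P ^ n] at the points of [S], where [Q] is the monic polynomial with
simple roots [A], gives first a Lame equation
[n (n + 1) Q P'' - 2 (d - 1) Q' P' = V P] with [V] of degree at most [n - 2], and
then an identity [c_0 V Q = c_1 Q Q'' + c_2 Q'^2] on [S].  Both sides have
degree at most [2 n - 2]; if [#|S| > 2 n - 2] they are equal as polynomials, and evaluation at
a root of [Q] forces [c_2 = 0].  But [c_2] is
[(d - 1) (n - 1) (2 n (n + 1) + (3 n + 2) (d - 1))], which is nonzero modulo [p]
when [n >= 3].  Hence [#|S| <= 2 n - 2] whenever [n >= 3].

For [D_k = A + B + C] with [#|A| <= #|B| <= #|C|], all sums [a + b + c] are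
distinct.  If [#|B| >= 3], the pair [B], [A + C] contradicts this bound, because
[A + C] has at least [2 #|B|] elements; otherwise [A + B] has four elements and
[C] has [d / 4].
*)

Set Implicit Arguments.
Unset Strict Implicit.
Unset Printing Implicit Defensive.

Import GRing.Theory.

(** * Polynomials with prescribed simple roots, and Lagrange interpolation *)

Section SplitPolynomial.
Local Open Scope ring_scope.
Variable F : finFieldType.
Implicit Types A S : {set F}.

Definition root_poly A : {poly F} := \prod_(a in A) ('X - a%:P).

Lemma root_polyE A : root_poly A = \prod_(a <- enum A) ('X - a%:P).
Proof. by rewrite /root_poly big_enum. Qed.

Lemma size_root_poly A : size (root_poly A) = #|A|.+1.
Proof. by rewrite root_polyE size_prod_XsubC cardE. Qed.

Lemma monic_root_poly A : root_poly A \is monic.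
Proof. by rewrite root_polyE monic_prod_XsubC. Qed.

Lemma root_root_poly A x : root (root_poly A) x = (x \in A).
Proof. by rewrite root_polyE root_prod_XsubC mem_enum. Qed.

Lemma root_polyD1 A a : a \in A ->
  root_poly A = ('X - a%:P) * root_poly (A :\ a).
Proof. by move=> aA; rewrite /root_poly (big_setD1 a). Qed.

Lemma horner_root_polyD1_neq0 A a : (root_poly (A :\ a)).[a] != 0.
Proof. by rewrite -rootE root_root_poly !inE eqxx. Qed.

Lemma horner_deriv_root_poly_neq0 A a : a \in A -> (root_poly A)^`().[a] != 0.
Proof.
move=> aA; rewrite (root_polyD1 aA) derivM derivXsubC mul1r hornerD hornerM.
by rewrite hornerXsubC subrr mul0r addr0 horner_root_polyD1_neq0.
Qed.

Lemma size_deriv_leq (g : {poly F}) : (size g^`() <= (size g).-1)%N.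
Proof. exact: size_poly. Qed.

Lemma size_polyM_leq (g h : {poly F}) i j :
  (size g <= i)%N -> (size h <= j)%N -> (size (g * h)%R <= (i + j).-1)%N.
Proof.
move=> gi hj; apply: leq_trans (size_polyMleq _ _) _.
by rewrite -!subn1 leq_sub2r // leq_add.
Qed.

Lemma size_deriv_root_poly A : (size (root_poly A)^`() <= #|A|)%N.
Proof. by apply: leq_trans (size_deriv_leq _) _; rewrite size_root_poly. Qed.

Lemma size_deriv2_root_poly A : (size (root_poly A)^`()^`() <= #|A|.-1)%N.
Proof.
apply: leq_trans (size_deriv_leq _) _.
by rewrite -!subn1 leq_sub2r // size_deriv_root_poly.
Qed.

Lemma poly_eq0_on A (g : {poly F}) :
  (size g <= #|A|)%N -> {in A, forall a, g.[a] = 0} -> g = 0.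
Proof.
move=> sg gA; apply: (@roots_geq_poly_eq0 _ _ (enum A)).
- by apply/allP => a; rewrite mem_enum => /gA /eqP.
- exact: enum_uniq.
- by rewrite -cardE.
Qed.

Lemma root_poly_dvdp A (g : {poly F}) :
  {in A, forall a, g.[a] = 0} -> root_poly A %| g.
Proof.
move=> gA; rewrite root_polyE; apply: uniq_roots_dvdp.
  by apply/allP => a; rewrite mem_enum => /gA /eqP.
by rewrite uniq_rootsE enum_uniq.
Qed.

Lemma root_poly_exp_dvdp A n (g : {poly F}) :
  {in A, forall a, ('X - a%:P) ^+ n %| g} -> root_poly A ^+ n %| g.
Proof.
move=> gA; rewrite root_polyE -prodrXl.
have: all (fun a => ('X - a%:P) ^+ n %| g) (enum A).
  by apply/allP => a; rewrite mem_enum => /gA.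
elim: (enum A) (enum_uniq A) => [|a r IHr] /=; first by rewrite big_nil dvd1p.
case/andP=> nar ur /andP[ga gr]; rewrite big_cons Gauss_dvdp ?ga ?IHr //.
rewrite prodrXl; apply: coprimep_expl; apply: coprimep_expr.
by rewrite coprimep_sym coprimep_XsubC root_prod_XsubC.
Qed.

Definition lagrange_weight A a : F := (root_poly (A :\ a)).[a]^-1.

Lemma lagrange_interpolation A (g : {poly F}) : (size g <= #|A|)%N ->
  \sum_(a in A) (g.[a] * lagrange_weight A a) *: root_poly (A :\ a) = g.
Proof.
move=> sg; apply/eqP; rewrite -subr_eq0; apply/eqP.
apply: (@poly_eq0_on A).
  apply: leq_trans (size_polyD _ _) _; rewrite geq_max size_polyN sg andbT.
  apply: leq_trans (size_sum _ _ _) _; apply/bigmax_leqP => a aA.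
  apply: leq_trans (size_scale_leq _ _) _.
  by rewrite size_root_poly [leqRHS](cardsD1 a A) aA.
move=> b bA; rewrite hornerD hornerN horner_sum (big_setD1 b) //= big1 => [|a].
  by rewrite hornerZ addr0 /lagrange_weight mulfVK ?subrr ?horner_root_polyD1_neq0.
rewrite !inE => /andP[ab aA]; rewrite hornerZ.
have /rootP-> : root (root_poly (A :\ a)) b by rewrite root_root_poly !inE bA eq_sym ab.
by rewrite mulr0.
Qed.

(** Compare coefficients of order [#|A|.-1] in the interpolation formula: each [root_poly (A :\ a)]
    is monic of that degree. *)
Lemma sum_lagrange_weight A (g : {poly F}) : (size g <= #|A|)%N ->
  \sum_(a in A) lagrange_weight A a * g.[a] = g`_(#|A|.-1).
Proof.
move=> sg; rewrite -[in RHS](lagrange_interpolation sg) coef_sum.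
apply: eq_bigr => a aA; rewrite coefZ mulrC.
have := monic_root_poly (A :\ a).
by rewrite monicE /lead_coef size_root_poly (cardsD1 a A) aA /= => /eqP->; rewrite mulr1.
Qed.

(** These are the values on [A] of [(-1) ^+ m *: ('X - x%:P) ^+ m], whose coefficient of order
    [#|A|.-1] vanishes for smaller [m]. *)
Lemma sum_lagrange_weight_exp A x m : (m < #|A|)%N ->
  \sum_(a in A) lagrange_weight A a * (x - a) ^+ m
    = (-1) ^+ m * (m == #|A|.-1)%:R.
Proof.
move=> mA; set g := (-1) ^+ m *: ('X - x%:P) ^+ m.
have sg : size g = m.+1 by rewrite size_scale ?expf_neq0 ?oppr_eq0 ?oner_eq0 // size_exp_XsubC.
transitivity (\sum_(a in A) lagrange_weight A a * g.[a]).
  by apply: eq_bigr => a _; rewrite hornerZ horner_exp hornerXsubC -(opprB a x) [in LHS]exprNn.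
rewrite sum_lagrange_weight ?sg // coefZ; congr (_ * _).
have [->|mn] := eqVneq.
  have /monicP := monic_exp #|A|.-1 (monicXsubC x).
  by rewrite /lead_coef size_exp_XsubC.
rewrite nth_default // size_exp_XsubC; lia.
Qed.

(** Interpolation of the constant 1; divided by [root_poly A], it is the partial fraction expansion
    of the inverse of [root_poly A]. *)
Lemma sum_lagrange_weight_poly A : (0 < #|A|)%N ->
  \sum_(a in A) lagrange_weight A a *: root_poly (A :\ a) = 1.
Proof.
move=> A0; rewrite -[RHS](@lagrange_interpolation A) ?size_poly1 //.
by apply: eq_bigr => a _; rewrite hornerC mul1r.
Qed.

End SplitPolynomial.

(** * Taylor coefficients of shifts and powers of polynomials *)

Section TaylorCoefficients.
Local Open Scope ring_scope.
Variable F : fieldType.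
Implicit Types p r : {poly F}.

Lemma coef_XaddC_exp b t m :
  (('X + b%:P) ^+ t)`_m = 'C(t, m)%:R * b ^+ (t - m) :> F.
Proof.
rewrite addrC exprDn coef_sum.
have [mt|tm] := ltnP m t.+1.
  rewrite (bigD1 (Ordinal mt)) //= big1 => [|i]; last first.
    rewrite -val_eqE /= => im.
    by rewrite coefMn -polyC_exp coefCM coefXn eq_sym (negPf im) mulr0 mul0rn.
  by rewrite addr0 coefMn -polyC_exp coefCM coefXn eqxx mulr1 mulr_natl.
rewrite bin_small // mul0r big1 // => i _.
rewrite coefMn -polyC_exp coefCM coefXn.
have -> : (m == i :> nat) = false by have := ltn_ord i; lia.
by rewrite mulr0 mul0rn.
Qed.

Lemma deriv_shift p s : (p \Po ('X + s%:P))^`() = p^`() \Po ('X + s%:P).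
Proof. by rewrite deriv_comp derivD derivX derivC addr0 mulr1. Qed.

Lemma horner_shift p s : p.[s] = (p \Po ('X + s%:P))`_0.
Proof. by rewrite -horner_coef0 horner_comp !hornerE. Qed.

(** The factor [r] avoids the exponent [m - 1]. The coefficients of order 0 and 1 of this identity
    give the recurrences [coef1_exp] and [coef2_exp]. *)
Lemma deriv_exp_mul r m : (r ^+ m)^`() * r = m%:R * (r ^+ m) * r^`().
Proof.
rewrite deriv_exp; case: m => [|m]; first by rewrite mulr0n !mul0r.
by rewrite /= exprS -mulr_natl; ring.
Qed.

Lemma coef1_exp r m : (r ^+ m)`_1 * r`_0 = m%:R * (r ^+ m)`_0 * r`_1.
Proof.
have := congr1 (fun g : {poly F} => g`_0) (deriv_exp_mul r m) => /=.
rewrite -mulrA mulr_natl coefMn !coef0M !coef_deriv => ->.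
by rewrite -mulr_natl; ring.
Qed.

Lemma coef2_exp r m : 2 * (r ^+ m)`_2 * r`_0
  = 2 * m%:R * (r ^+ m)`_0 * r`_2 + (m%:R - 1) * (r ^+ m)`_1 * r`_1.
Proof.
have := congr1 (fun g : {poly F} => g`_1) (deriv_exp_mul r m) => /=.
rewrite -mulrA mulr_natl coefMn !coefM !big_ord_recl !big_ord0 /= !coef_deriv.
rewrite -[_ *+ m]mulr_natl => /eqP; rewrite -subr_eq0 => /eqP h.
by apply/eqP; rewrite -subr_eq0 -[X in _ == X]h /bump !leqnn !addn0 !subn0 !subnn /=; apply/eqP; ring.
Qed.

End TaylorCoefficients.

(** * Weighted sums of powers of [(s - a)^-1] *)

Section ReciprocalSums.
Local Open Scope ring_scope.
Variables (F : finFieldType) (A : {set F}) (s : F).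
Hypotheses (A_gt0 : (0 < #|A|)%N) (sA : s \notin A) (two_neq0 : 2 != 0 :> F).
Local Notation c := (lagrange_weight A).
Local Notation Q := (root_poly A).
Local Notation E := (fun m => \sum_(a in A) c a * ((s - a)^-1) ^+ m).

Lemma subr_notin_neq0 a : a \in A -> s - a != 0.
Proof. by move=> aA; rewrite subr_eq0; apply: contraNneq sA => ->. Qed.

Lemma root_poly_neq0_notin : Q.[s] != 0.
Proof. by rewrite -rootE root_root_poly. Qed.

(** The partial fraction expansion of [1 / Q] at [s]. The next two sums come from the first two
    derivatives of the same expansion, with denominators cleared. *)
Lemma sum_recip1 : E 1%N = Q.[s]^-1.
Proof.
apply: (mulIf root_poly_neq0_notin); rewrite mulVf ?root_poly_neq0_notin //.
rewrite -[RHS](hornerC 1 s) polyC1 -(sum_lagrange_weight_poly A_gt0).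
rewrite horner_sum mulr_suml; apply: eq_bigr => a aA.
rewrite hornerZ (root_polyD1 aA) hornerM hornerXsubC -mulrA expr1.
by rewrite mulKf ?subr_notin_neq0.
Qed.

Lemma horner_deriv_root_polyD1 a : a \in A ->
  (root_poly (A :\ a))^`().[s]
    = Q^`().[s] * (s - a)^-1 - Q.[s] * (s - a)^-1 ^+ 2.
Proof.
move=> aA; have sa := subr_notin_neq0 aA.
rewrite (root_polyD1 aA) derivM derivXsubC mul1r !hornerD !hornerM hornerXsubC.
by field.
Qed.

Lemma horner_deriv2_root_polyD1 a : a \in A ->
  (root_poly (A :\ a))^`()^`().[s]
    = Q^`()^`().[s] * (s - a)^-1 - 2 * Q^`().[s] * (s - a)^-1 ^+ 2
      + 2 * Q.[s] * (s - a)^-1 ^+ 3.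
Proof.
move=> aA; have sa := subr_notin_neq0 aA.
rewrite (root_polyD1 aA) derivM derivXsubC mul1r derivD derivM derivXsubC mul1r.
rewrite !hornerD !hornerM hornerXsubC.
by field.
Qed.

Lemma sum_recip2 : E 2%N = Q^`().[s] / Q.[s] ^+ 2.
Proof.
have q0 := root_poly_neq0_notin.
have : Q^`().[s] * E 1%N - Q.[s] * E 2%N = 0.
  rewrite -[RHS](horner0 s) -(derivC 1) polyC1 -(sum_lagrange_weight_poly A_gt0).
  rewrite raddf_sum horner_sum !mulr_sumr -sumrB; apply: eq_bigr => a aA.
  rewrite /= derivZ hornerZ horner_deriv_root_polyD1 // expr1. ring.
rewrite sum_recip1 => /eqP; rewrite subr_eq0 => /eqP h.
by apply: (mulfI q0); rewrite -h; field.
Qed.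

Lemma sum_recip3 :
  E 3%N = Q^`().[s] ^+ 2 / Q.[s] ^+ 3 - Q^`()^`().[s] / (2 * Q.[s] ^+ 2).
Proof.
have q0 := root_poly_neq0_notin.
have : Q^`()^`().[s] * E 1%N - 2 * Q^`().[s] * E 2%N + 2 * Q.[s] * E 3%N = 0.
  rewrite -[RHS](horner0 s) -(deriv0) -(derivC 1) polyC1 -(sum_lagrange_weight_poly A_gt0).
  rewrite !raddf_sum horner_sum !mulr_sumr -sumrB -big_split; apply: eq_bigr => a aA.
  by rewrite /= !derivZ hornerZ horner_deriv2_root_polyD1 //; ring.
rewrite sum_recip1 sum_recip2 addrC => /eqP; rewrite addr_eq0 => /eqP h.
have qq0 : 2 * Q.[s] != 0 by rewrite mulf_neq0.
by apply: (mulfI qq0); rewrite h; field; rewrite q0.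
Qed.

End ReciprocalSums.

(** * Stepanov's polynomial and the product bound *)

Section StepanovPolynomial.
Local Open Scope ring_scope.
Variables (F : finFieldType) (A S : {set F}) (d : nat).
Local Notation n := #|A|.
Local Notation T := (n.-1 + d)%N.
Local Notation c := (lagrange_weight A).
Local Notation Q := (root_poly A).
Local Notation P := (root_poly S).
Definition stepanov_poly : {poly F} :=
  \sum_(a in A) c a *: ('X - a%:P) ^+ T - ((-1) ^+ n.-1)%:P.
Local Notation f := stepanov_poly.

Lemma coef_stepanov_shift s m : (f \Po ('X + s%:P))`_m =
  'C(T, m)%:R * \sum_(a in A) c a * (s - a) ^+ (T - m)
    - (-1) ^+ n.-1 * (m == 0%N)%:R.
Proof.
rewrite /stepanov_poly comp_polyB comp_polyC coefB coefC.
congr (_ - _); last by case: eqP; rewrite ?mulr1 ?mulr0.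
rewrite raddf_sum coef_sum mulr_sumr; apply: eq_bigr => a aA /=.
rewrite comp_polyZ coefZ rmorphXn /= comp_polyB comp_polyX comp_polyC.
by rewrite -addrA -polyCB coef_XaddC_exp mulrCA.
Qed.

Hypotheses (A_gt0 : (0 < n)%N) (d_gt0 : (0 < d)%N).
Hypothesis fact_neq0 : T`!%:R != 0 :> F.
Hypothesis diff_pow : {in S & A, forall s a, (s - a) ^+ d = 1}.

(** The factorial hypothesis says that the characteristic exceeds [T]; it makes all the integers and
    binomial coefficients below invertible. *)
Lemma natr_neq0_le_fact m : (0 < m <= T)%N -> m%:R != 0 :> F.
Proof.
move=> mT; apply: contraNneq fact_neq0 => m0.
by have /dvdnP[q ->] := dvdn_fact mT; rewrite natrM m0 mulr0.
Qed.

Lemma bin_neq0_le_fact m : (m <= T)%N -> 'C(T, m)%:R != 0 :> F.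
Proof.
move=> mT; apply: contraNneq fact_neq0 => C0.
by rewrite -(bin_fact mT) natrM C0 mul0r.
Qed.

(** Since [(s - a) ^+ d = 1], the exponent [T - m] drops to [n.-1 - m]. The weighted power sum then
    vanishes for [0 < m], and for [m = 0] it equals the constant subtracted in [stepanov_poly]. *)
Lemma coef_stepanov_shift_lt s m : s \in S -> (m < n)%N ->
  (f \Po ('X + s%:P))`_m = 0.
Proof.
move=> sS mn; rewrite coef_stepanov_shift.
under eq_bigr => a aA.
  have -> : (T - m = (n.-1 - m) + d)%N by lia.
  rewrite exprD diff_pow // mulr1; over.
rewrite /= sum_lagrange_weight_exp; last by rewrite (leq_ltn_trans (leq_subr _ _)) ?ltn_predL.
case: m mn => [|m] mn; first by rewrite subn0 !eqxx bin0 mul1r subrr.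
have -> : (n.-1 - m.+1 == n.-1)%N = false by lia.
by rewrite !mulr0 subrr.
Qed.

Lemma XsubC_exp_dvdp_stepanov s : s \in S -> ('X - s%:P) ^+ n %| f.
Proof.
move=> sS; rewrite -(comp_polyXaddC_K f s).
have -> : f \Po ('X + s%:P) = drop_poly n (f \Po ('X + s%:P)) * 'X^n.
  rewrite -[LHS](poly_take_drop n) (_ : take_poly n _ = 0) ?add0r //.
  apply/polyP => m; rewrite coef_take_poly coef0.
  by case: ifP => // /coef_stepanov_shift_lt ->.
by rewrite comp_polyM comp_Xn_poly dvdp_mull.
Qed.

Lemma coef_stepanov m : (0 < m)%N ->
  f`_m = 'C(T, m)%:R * \sum_(a in A) c a * (0 - a) ^+ (T - m).
Proof.
move=> m0; rewrite -[f in LHS]comp_polyXr -['X]addr0 -polyC0 coef_stepanov_shift.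
by rewrite (gtn_eqF m0) mulr0 subr0.
Qed.

(** A coefficient of order between [d + 1] and [T] carries a weighted power sum of exponent below
    [n.-1], hence zero; at order [d] the sum is a sign and the binomial coefficient is
    invertible. *)
Lemma size_stepanov : size f = d.+1.
Proof.
apply/eqP; rewrite eqn_leq; apply/andP; split.
  apply/leq_sizeP => m dm; rewrite coef_stepanov; last by lia.
  have [Tm|mT] := ltnP T m; first by rewrite bin_small // mul0r.
  rewrite sum_lagrange_weight_exp; last by lia.
  have -> : (T - m == n.-1)%N = false by lia.
  by rewrite !mulr0.
rewrite ltnNge; apply/negP => /leq_sizeP /(_ d (leqnn d)) /eqP; apply/negP.
rewrite coef_stepanov // sum_lagrange_weight_exp; last by lia.
rewrite addnK eqxx mulr1 mulf_neq0 ?signr_eq0 //.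
by apply: bin_neq0_le_fact; lia.
Qed.

Lemma stepanov_neq0 : f != 0.
Proof. by rewrite -size_poly_gt0 size_stepanov. Qed.

Lemma size_root_poly_exp : size (P ^+ n) = (#|S| * n).+1.
Proof.
have P0 : P ^+ n != 0 by rewrite expf_neq0 // monic_neq0 // monic_root_poly.
by rewrite -[LHS]prednK ?size_poly_gt0 // size_exp size_root_poly.
Qed.

Lemma root_poly_exp_dvdp_stepanov : P ^+ n %| f.
Proof. by apply: root_poly_exp_dvdp => s /XsubC_exp_dvdp_stepanov. Qed.

Lemma hanson_petridis : (n * #|S| <= d)%N.
Proof.
have := dvdp_leq stepanov_neq0 root_poly_exp_dvdp_stepanov.
by rewrite size_root_poly_exp size_stepanov ltnS mulnC.
Qed.

Lemma stepanov_extremal : (n * #|S| = d)%N ->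
  exists2 K, K != 0 & f = K *: P ^+ n.
Proof.
move=> nS; have /dvdpP[q fE] := root_poly_exp_dvdp_stepanov.
have P0 : P ^+ n != 0 by rewrite expf_neq0 // monic_neq0 // monic_root_poly.
have q0 : q != 0 by apply: contraTneq stepanov_neq0 => q0; rewrite fE q0 mul0r eqxx.
have /eqP/size_poly1P[K K0 qE] : size q = 1%N.
  have := size_stepanov; rewrite fE size_mul // size_root_poly_exp -nS mulnC addnS /=.
  by rewrite -add1n => /addIn.
by exists K => //; rewrite fE qE mul_polyC.
Qed.

End StepanovPolynomial.

(** * The equality case: differential equations for [P] *)

Section ExtremalPair.
Local Open Scope ring_scope.
Variables (F : finFieldType) (A S : {set F}) (d : nat).
Local Notation n := #|A|.
Local Notation T := (n.-1 + d)%N.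
Local Notation D := (d%:R - 1 : F).
Local Notation Q := (root_poly A).
Local Notation P := (root_poly S).
Hypotheses (A_gt0 : (0 < n)%N) (d_gt2 : (2 < d)%N).
Hypothesis fact_neq0 : T`!%:R != 0 :> F.
Hypothesis diff_pow : {in S & A, forall s a, (s - a) ^+ d = 1}.
Hypothesis card_mul : (n * #|S| = d)%N.

Let d_gt0 : (0 < d)%N. Proof. exact: leq_trans d_gt2. Qed.

Lemma extremal_notin s : s \in S -> s \notin A.
Proof.
move=> sS; apply/negP => sA; have := diff_pow sS sA.
by rewrite subrr expr0n (gtn_eqF d_gt0) => /eqP; rewrite eq_sym oner_eq0.
Qed.

(** Here [T - (n + i) = d - (i + 1)], so [(s - a) ^+ d = 1] turns the power into a reciprocal
    one. *)
Lemma coef_stepanov_shift_recip s i : s \in S -> (i < 3)%N ->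
  (stepanov_poly A d \Po ('X + s%:P))`_(n + i) =
    'C(T, n + i)%:R * \sum_(a in A) lagrange_weight A a * (s - a)^-1 ^+ i.+1.
Proof.
move=> sS i3; rewrite coef_stepanov_shift addn_eq0 (gtn_eqF A_gt0) mulr0 subr0.
congr (_ * _); apply: eq_bigr => a aA; congr (_ * _).
have sa := subr_notin_neq0 (extremal_notin sS) aA.
apply: (mulIf (expf_neq0 i.+1 sa)).
rewrite -exprMn mulVf // expr1n -exprD -[RHS](diff_pow sS aA).
by congr (_ ^+ _); move: A_gt0 d_gt2 i3; lia.
Qed.

Lemma binS_natr m : (m < T)%N ->
  'C(T, m.+1)%:R = 'C(T, m)%:R * (T - m)%:R / m.+1%:R :> F.
Proof.
move=> mT; have m1 : m.+1%:R != 0 :> F by apply: natr_neq0_le_fact fact_neq0 _ _.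
by apply: (mulIf m1); rewrite mulfVK // -!natrM mulnC mul_bin_left mulnC.
Qed.

(** For [s] in [S] this is [P(X + s) / X], so the Taylor coefficient of [P ^+ n] of order [n + i] at
    [s] is the coefficient of order [i] of its [n]th power. *)
Let P_shift s := drop_poly 1 (P \Po ('X + s%:P)).

Lemma coef_P_shift s i : (P_shift s)`_i = (P \Po ('X + s%:P))`_i.+1.
Proof. by rewrite coef_drop_poly addn1. Qed.

Lemma stepanov_shift_factor s : s \in S -> exists2 K, K != 0 &
  forall i, (stepanov_poly A d \Po ('X + s%:P))`_(n + i) = K * (P_shift s ^+ n)`_i.
Proof.
move=> sS; have [K K0 fE] := stepanov_extremal A_gt0 d_gt0 fact_neq0 diff_pow card_mul.
exists K => // i; rewrite fE comp_polyZ rmorphXn coefZ /=; congr (_ * _).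
have -> : P \Po ('X + s%:P) = P_shift s * 'X.
  rewrite -[LHS](poly_take_drop 1) expr1 (_ : take_poly 1 _ = 0) ?add0r //.
  apply/polyP => -[|m]; rewrite coef_take_poly coef0 //= -horner_shift.
  by apply/eqP; rewrite -rootE root_root_poly.
by rewrite exprMn coefMXn ltnNge leq_addr addKn.
Qed.

Lemma extremal_deriv s : s \in S ->
  [/\ P^`().[s] = (P_shift s)`_0, P^`()^`().[s] = 2 * (P_shift s)`_1
    & P^`()^`()^`().[s] = 6 * (P_shift s)`_2].
Proof.
move=> sS; rewrite !horner_shift -!deriv_shift !coef_deriv !coef_P_shift.
split; ring.
Qed.

Lemma natr_range_neq0 m : (0 < m <= n + 2)%N -> m%:R != 0 :> F.
Proof.
by move=> m2; apply: (natr_neq0_le_fact fact_neq0); move: A_gt0 d_gt2 m2; lia.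
Qed.

(** The scalar [b] is ['C(T, n)]; each further order brings a ratio of consecutive binomial
    coefficients, where [T - n = d - 1], and the next reciprocal sum. *)
Lemma stepanov_shift_coefs s : s \in S -> exists2 b, b != 0 &
  [/\ (stepanov_poly A d \Po ('X + s%:P))`_(n + 0) = b / Q.[s],
      (stepanov_poly A d \Po ('X + s%:P))`_(n + 1)
        = b * D / (n%:R + 1) * (Q^`().[s] / Q.[s] ^+ 2)
    & (stepanov_poly A d \Po ('X + s%:P))`_(n + 2)
        = b * D / (n%:R + 1) * (D - 1) / (n%:R + 2)
          * (Q^`().[s] ^+ 2 / Q.[s] ^+ 3 - Q^`()^`().[s] / (2 * Q.[s] ^+ 2))].
Proof.
move=> sS; have sA := extremal_notin sS.
have two0 : 2 != 0 :> F by apply: natr_range_neq0; rewrite leq_addl.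
exists 'C(T, n)%:R; first by apply: (bin_neq0_le_fact fact_neq0); lia.
have -> : D = (T - n)%:R.
  by apply/eqP; rewrite subr_eq natr1; apply/eqP; congr _%:R; move: A_gt0; lia.
have -> : (T - n)%:R - 1 = (T - n.+1)%:R :> F.
  apply/eqP; rewrite subr_eq natr1; apply/eqP; congr _%:R.
  by move: A_gt0 d_gt2; lia.
rewrite natr1 -natrD !coef_stepanov_shift_recip // sum_recip1 // sum_recip2 // sum_recip3 //.
rewrite addn0 addn1 addn2 !binS_natr //; move: A_gt0 d_gt2; lia.
Qed.

Lemma stepanov_factor_coefs s : s \in S ->
  exists2 K, K != 0 & forall i,
    (P_shift s ^+ n)`_i = (stepanov_poly A d \Po ('X + s%:P))`_(n + i) / K.
Proof.
move=> /stepanov_shift_factor[K K0 fE].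
by exists K => // i; rewrite fE mulrC mulKf.
Qed.

(** The coefficients of order [n] and [n + 1] are known up to the common scalar [b / K], which
    [coef1_exp] eliminates. *)
Lemma extremal_deriv2 s : s \in S ->
  n%:R * (n%:R + 1) * Q.[s] * P^`()^`().[s] = 2 * D * Q^`().[s] * P^`().[s].
Proof.
move=> sS; have [b b0 [f0 f1 _]] := stepanov_shift_coefs sS.
have [K K0 fE] := stepanov_factor_coefs sS.
have q0 := root_poly_neq0_notin (extremal_notin sS).
have n1 : n%:R + 1 != 0 :> F by rewrite natr1 natr_range_neq0 // addn2 leqnSn.
have [-> -> _] := extremal_deriv sS.
have := coef1_exp (P_shift s) n; rewrite !fE f0 f1.
move: (P_shift s)`_0 (P_shift s)`_1 Q^`().[s] Q.[s] q0 n1 => r0 r1 q1 q q0.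
move: (n%:R : F) D => N D n1 h.
have c0 : b / (q ^+ 2 * K * (N + 1)) != 0 by rewrite !(mulf_neq0, invr_neq0, expf_neq0).
apply: (mulfI c0).
transitivity (2 * (N * (b / q / K) * r1)); first by field; rewrite q0 K0 n1.
by rewrite -h; field; rewrite q0 K0 n1.
Qed.

(** The same elimination one order further, by [coef2_exp]. *)
Lemma extremal_deriv3 s : s \in S ->
  2 * n%:R * (n%:R + 1) * (n%:R + 2) * Q.[s] ^+ 2 * P^`()^`()^`().[s]
  = 6 * D * (D - 1) * (2 * Q^`().[s] ^+ 2 - Q.[s] * Q^`()^`().[s]) * P^`().[s]
    - 3 * (n%:R - 1) * (n%:R + 2) * D * Q.[s] * Q^`().[s] * P^`()^`().[s].
Proof.
move=> sS; have [b b0 [f0 f1 f2]] := stepanov_shift_coefs sS.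
have [K K0 fE] := stepanov_factor_coefs sS.
have q0 := root_poly_neq0_notin (extremal_notin sS).
have n1 : n%:R + 1 != 0 :> F by rewrite natr1 natr_range_neq0 // addn2 leqnSn.
have n2 : n%:R + 2 != 0 :> F by rewrite -natrD natr_range_neq0 // addn2 leqnn.
have two0 : 2 != 0 :> F by apply: natr_range_neq0; rewrite leq_addl.
have [-> -> ->] := extremal_deriv sS.
have := coef2_exp (P_shift s) n; rewrite !fE f0 f1 f2.
move: (P_shift s)`_0 (P_shift s)`_1 (P_shift s)`_2 => r0 r1 r2.
move: Q^`()^`().[s] Q^`().[s] Q.[s] q0 n1 n2 => q2 q1 q q0.
move: (n%:R : F) D => N D n1 n2 h.
have c0 : b / (q ^+ 3 * K * (N + 1) * (N + 2)) != 0.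
  by rewrite !(mulf_neq0, invr_neq0, expf_neq0).
apply: (mulfI c0).
transitivity (6 * (2 * N * (b / q / K) * r2)); first by field; rewrite q0 K0 n1 n2.
move/eqP: h; rewrite -subr_eq => /eqP <-.
by field; rewrite q0 K0 n1 n2 two0.
Qed.

(** The left side vanishes on [S] by [extremal_deriv2], hence is a multiple of [P]; its degree is at
    most [n + #|S| - 2], which bounds that of the cofactor [V]. *)
Lemma extremal_lame : exists2 V : {poly F}, (size V < n)%N &
  (n%:R * (n%:R + 1)) *: (Q * P^`()^`()) - (2 * D) *: (Q^`() * P^`()) = V * P.
Proof.
set W := (X in exists2 V : {poly F}, _ & X = _).
have /dvdpP[V WE] : P %| W.
  apply: root_poly_dvdp => s sS; rewrite hornerD hornerN !hornerZ !hornerM.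
  have := extremal_deriv2 sS; rewrite -!mulrA => ->; exact: subrr.
exists V => //.
have S_gt0 : (0 < #|S|)%N by move: d_gt0; rewrite -card_mul muln_gt0 => /andP[].
have Q_size : (size Q <= n.+1)%N by rewrite size_root_poly.
have W_size : (size W < n + #|S|)%N.
  apply: leq_ltn_trans (size_polyD _ _) _; rewrite size_polyN gtn_max.
  apply/andP; split; apply: leq_ltn_trans (size_scale_leq _ _) _.
    apply: leq_ltn_trans (size_polyM_leq Q_size (size_deriv2_root_poly S)) _.
    by move: S_gt0; lia.
  apply: leq_ltn_trans (size_polyM_leq (size_deriv_root_poly A) (size_deriv_root_poly S)) _.
  by move: A_gt0; lia.
have [->|V0] := eqVneq V 0; first by rewrite size_poly0.
move: W_size; rewrite WE size_Mmonic ?monic_root_poly // size_root_poly addnS /=.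
by rewrite ltn_add2r.
Qed.

(* Substitutes the values of [P''] and [P'''] at a root of [P] into the
   derivative of the equation of [extremal_lame], with [N], [D], [q], [q1], [q2],
   [p1], [p2], [p3], [v] standing for [n], [d - 1], [Q], [Q'], [Q''], [P'], [P''],
   [P'''], [V]. *)
Lemma lame_elimination (N D q q1 q2 p1 p2 p3 v : F) :
  2 != 0 :> F -> N != 0 -> N + 1 != 0 -> N + 2 != 0 -> q != 0 -> p1 != 0 ->
  2 * N * (N + 1) * (N + 2) * q ^+ 2 * p3
    = 6 * D * (D - 1) * (2 * q1 ^+ 2 - q * q2) * p1
      - 3 * (N - 1) * (N + 2) * D * q * q1 * p2 ->
  N * (N + 1) * q * p2 = 2 * D * q1 * p1 ->
  N * (N + 1) * (q1 * p2 + q * p3) - 2 * D * (q2 * p1 + q1 * p2) = v * p1 ->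
  N * (N + 1) * (N + 2) * (v * q)
    - (- (N * (N + 1) * D * (2 * (N + 2) + 3 * (D - 1))) * (q * q2)
       + D * ((N - 1) * (2 * N * (N + 1) + (3 * N + 2) * D)) * (q1 * q1)) = 0.
Proof.
move=> two0 N0 N1 N2 q0 p0 p3E p2E vE.
have {}p2E : p2 = 2 * D * q1 * p1 / (N * (N + 1) * q).
  by rewrite -p2E mulrC mulKf // !mulf_neq0.
have {}p3E : p3 = (6 * D * (D - 1) * (2 * q1 ^+ 2 - q * q2) * p1
    - 3 * (N - 1) * (N + 2) * D * q * q1 * p2)
      / (2 * N * (N + 1) * (N + 2) * q ^+ 2).
  by rewrite -p3E mulrC mulKf // !mulf_neq0 ?expf_neq0.
have {}vE : v = (N * (N + 1) * (q1 * p2 + q * p3)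
    - 2 * D * (q2 * p1 + q1 * p2)) / p1.
  by rewrite vE mulfK.
rewrite vE p3E p2E; field.
by rewrite p0 q0 N0 N1 N2 two0.
Qed.

Lemma extremal_card_leq :
  (n%:R - 1) * (2 * n%:R * (n%:R + 1) + (3 * n%:R + 2) * D) != 0 ->
  (#|S| <= 2 * n.-1)%N.
Proof.
move=> nD0; have [V V_size VE] := extremal_lame; rewrite leqNgt; apply/negP => S_gt.
have D0 : D != 0.
  rewrite -(@natrB _ d 1) //; apply: (natr_neq0_le_fact fact_neq0).
  by move: d_gt2; lia.
pose c1 := - (n%:R * (n%:R + 1) * D * (2 * (n%:R + 2) + 3 * (D - 1))).
pose c2 := D * ((n%:R - 1) * (2 * n%:R * (n%:R + 1) + (3 * n%:R + 2) * D)).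
have Q_size : (size Q <= n.+1)%N by rewrite size_root_poly.
(* [Z] has at most [2 * n - 1] coefficients, and [S_gt] gives at least as many points in [S]. *)
pose Z := (n%:R * (n%:R + 1) * (n%:R + 2)) *: (V * Q)
  - (c1 *: (Q * Q^`()^`()) + c2 *: (Q^`() ^+ 2)).
have Z0 : Z = 0.
  apply: (@poly_eq0_on _ S).
    apply: leq_trans S_gt; apply: leq_trans (size_polyD _ _) _.
    rewrite size_polyN geq_max; apply/andP; split.
      apply: leq_trans (size_scale_leq _ _) _.
      apply: leq_trans (size_polyM_leq (leqnn _) Q_size) _.
      by move: V_size; lia.
    apply: leq_trans (size_polyD _ _) _; rewrite geq_max expr2.
    apply/andP; split; apply: leq_trans (size_scale_leq _ _) _.
      apply: leq_trans (size_polyM_leq Q_size (size_deriv2_root_poly A)) _.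
      by move: A_gt0; lia.
    apply: leq_trans (size_polyM_leq (size_deriv_root_poly A) (size_deriv_root_poly A)) _.
    by move: A_gt0; lia.
  move=> s sS; rewrite /Z !(hornerD, hornerN, hornerZ, hornerM, horner_exp).
  (* Differentiating the Lame equation at [s] introduces [V'] only through [V' P], which is zero
     there. *)
  have := congr1 (fun g : {poly F} => g^`().[s]) VE => /=.
  rewrite derivB !derivZ !derivM hornerD hornerN !hornerZ !hornerD !hornerM.
  have /rootP -> : root P s by rewrite root_root_poly.
  rewrite mulr0 add0r.
  have := extremal_deriv2 sS; have := extremal_deriv3 sS.
  have := horner_deriv_root_poly_neq0 sS; have q0 := root_poly_neq0_notin (extremal_notin sS).
  rewrite /c1 /c2; move: q0.
  move: Q^`()^`().[s] Q^`().[s] Q.[s] => q2 q1 q.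
  move: P^`()^`()^`().[s] P^`()^`().[s] P^`().[s] V.[s] => p3 p2 p1 v.
  apply: lame_elimination.
  - by apply: natr_range_neq0; rewrite leq_addl.
  - by apply: natr_range_neq0; rewrite A_gt0 leq_addr.
  - by rewrite natr1 natr_range_neq0 // addn2 leqnSn.
  - by rewrite -natrD natr_range_neq0 // addn2 leqnn.
(* At a root of [Q] only the [c2] term of [Z] survives, and [Q'] is nonzero there. *)
have [a aA] := card_gt0P A_gt0.
have := congr1 (horner^~ a) Z0; rewrite /Z !(hornerD, hornerN, hornerZ, hornerM, horner_exp).
have /rootP -> : root Q a by rewrite root_root_poly.
rewrite horner0 !mulr0 mul0r mulr0 !add0r => /eqP.
rewrite oppr_eq0; apply/negP.
by rewrite mulf_neq0 // mulf_neq0 ?horner_deriv_root_poly_neq0 // mulf_neq0.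
Qed.

End ExtremalPair.

(** * Sumsets and direct sums in a finite abelian group *)

Section Sumsets.
Local Open Scope ring_scope.
Variable V : finZmodType.
Implicit Types X Y Z : {set V}.

Lemma sumsetC X Y : sumset X Y = sumset Y X.
Proof.
by apply/setP => v; apply/imset2P/imset2P => -[x y xX yY ->];
  exists y x; rewrite // addrC.
Qed.

Lemma sumsetA X Y Z : sumset X (sumset Y Z) = sumset (sumset X Y) Z.
Proof.
apply/setP => v; apply/imset2P/imset2P.
  move=> [x _ xX /imset2P[y z yY zZ ->] ->].
  by exists (x + y) z; rewrite ?addrA // imset2_f.
move=> [_ z /imset2P[x y xX yY ->] zZ ->].
by exists x (y + z); rewrite ?addrA // imset2_f.
Qed.

Lemma card_sumset_leq X Y : (#|sumset X Y| <= #|X| * #|Y|)%N.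
Proof. by rewrite -cardsX /sumset curry_imset2X leq_imset_card. Qed.

Lemma leq_card_sumset X Y : Y != set0 -> (#|X| <= #|sumset X Y|)%N.
Proof.
case/set0Pn => y yY; rewrite -(card_imset X (addIr y)).
by apply: subset_leq_card; apply/subsetP => _ /imsetP[x xX ->]; rewrite imset2_f.
Qed.

Lemma card_sumset_inj X Y : #|sumset X Y| = (#|X| * #|Y|)%N ->
  forall x y x' y', x \in X -> y \in Y -> x' \in X -> y' \in Y ->
  x + y = x' + y' -> y = y'.
Proof.
rewrite -cardsX /sumset curry_imset2X => /eqP/imset_injP inj x y x' y' xX yY x'X y'Y.
move=> xy; suff [] : (x, y) = (x', y') by [].
by apply: inj; rewrite ?in_setX ?xX ?x'X.
Qed.

(** Adding a fixed [z] from [Z] turns a collision in [X + Y] into one in [(X + Z) + Y]. *)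
Lemma card_sumset_direct X Y Z : Z != set0 ->
  #|sumset (sumset X Z) Y| = (#|sumset X Z| * #|Y|)%N ->
  #|sumset X Y| = (#|X| * #|Y|)%N.
Proof.
case/set0Pn => z zZ /card_sumset_inj inj.
rewrite -cardsX /sumset curry_imset2X; apply/eqP/imset_injP.
move=> [x y] [x' y']; rewrite !in_setX => /andP[xX yY] /andP[x'X y'Y] /= xy.
have yy' : y = y'.
  apply: (inj (x + z) y (x' + z) y') => //; try exact: imset2_f.
  by rewrite addrAC xy addrAC.
by move: xy; rewrite yy' => /addIr ->.
Qed.

End Sumsets.

(** * The group of [k]th powers modulo [p] *)

Section PowerResidues.
Local Open Scope ring_scope.
Variables (k p d : nat).
Hypotheses (p_prime : prime p) (k_gt1 : (1 < k)%N) (pE : p = (k * d).+1).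
Local Notation D := (kth_powers p k).

Let d_gt0 : (0 < d)%N.
Proof.
by rewrite lt0n; apply: contraTneq (prime_gt1 p_prime) => d0; rewrite pE d0 muln0.
Qed.

Lemma Fp_fermat (x : 'F_p) : x != 0 -> x ^+ (k * d) = 1.
Proof.
move=> x0; apply: (mulfI x0); rewrite mulr1 -exprS -pE.
by rewrite -[X in x ^+ X](card_Fp p_prime) expf_card.
Qed.

Lemma kth_powers_exp x : x \in D -> x ^+ d = 1.
Proof. by case/imsetP => y; rewrite inE => y0 ->; rewrite -exprM Fp_fermat. Qed.

Lemma card_unity_roots_leq (F : finFieldType) m (c : F) : (0 < m)%N ->
  (#|[set x : F | x ^+ m == c]| <= m)%N.
Proof.
move=> m0; have sz : size ('X^m - c%:P) = m.+1 by rewrite size_XnsubC.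
rewrite cardE -ltnS -sz; apply: max_poly_roots (enum_uniq _).
  by rewrite -size_poly_gt0 sz.
apply/allP => x; rewrite mem_enum inE => /eqP xc.
by rewrite rootE !hornerE xc subrr.
Qed.

(** At most [d], since all are roots of [X^d - 1]; at least [d], since the [k * d] nonzero elements
    lie in fibres of [x ^+ k] of size at most [k]. *)
Lemma card_kth_powers : #|D| = d.
Proof.
apply/eqP; rewrite eqn_leq; apply/andP; split.
  apply: leq_trans (card_unity_roots_leq (1 : 'F_p) d_gt0).
  by apply: subset_leq_card; apply/subsetP => x /kth_powers_exp xd; rewrite inE xd.
have : (#|[set x : 'F_p | x != 0%R]| <= #|D| * k)%N.
  rewrite -sum1_card (partition_big_imset (fun x : 'F_p => x ^+ k)) /=.
  rewrite -sum_nat_const; have -> : [set x ^+ k | x in [set x : 'F_p | x != 0]] = D.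
    by apply/setP => y; apply/imsetP/imsetP => -[x x0 ->]; exists x; move: x0; rewrite ?inE.
  apply: leq_sum => y _; apply: leq_trans (card_unity_roots_leq y (ltnW k_gt1)).
  by rewrite -sum1_card; rewrite big_mkcond [leqRHS]big_mkcond; apply: leq_sum => x _;
     rewrite !inE; case: eqP; rewrite ?andbF //; case: ifP.
have -> : [set x : 'F_p | x != 0%R] = ~: [set 0] by apply/setP => x; rewrite !inE.
rewrite cardsC1 card_Fp // pE /= mulnC leq_pmul2r //; exact: ltnW.
Qed.

Lemma natr_Fp_neq0 m : (0 < m < p)%N -> m%:R != 0 :> 'F_p.
Proof.
by case/andP=> m0 mp; rewrite -(dvdn_pcharf (pchar_Fp p_prime)) gtnNdvd.
Qed.

Lemma fact_Fp_neq0 m : (m < p)%N -> m`!%:R != 0 :> 'F_p.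
Proof.
elim: m => [|m IHm] mp; first by rewrite oner_eq0.
rewrite factS natrM mulf_neq0 //; first exact: natr_Fp_neq0 _.
exact: IHm (ltnW mp).
Qed.

(** * Decompositions into two summands *)

Section Decomposition.
Variables A S : {set 'F_p}.
Hypothesis decomposition : D = sumset A S.

Let opp_A : {set 'F_p} := [set - a | a in A].

Let card_opp_A : #|opp_A| = #|A|.
Proof. by rewrite card_imset //; exact: oppr_inj. Qed.

Let summands_neq0 : A != set0 /\ S != set0.
Proof.
have /card_gt0P[x] : (0 < #|D|)%N by rewrite card_kth_powers.
rewrite decomposition => /imset2P[a s aA sS _].
by split; apply/set0Pn; [exists a | exists s].
Qed.

Let card_leq_d : (#|A| <= d)%N.
Proof.
rewrite -card_kth_powers decomposition; apply: leq_card_sumset.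
by have [] := summands_neq0.
Qed.

Let fact_neq0 : (#|opp_A|.-1 + d)`!%:R != 0 :> 'F_p.
Proof.
rewrite card_opp_A; apply: fact_Fp_neq0; rewrite [ltnRHS]pE ltnS.
(* With [#|A| <= d], this gives [#|A|.-1 + d < 2 * d <= p - 1]. *)
have : (2 * d <= k * d)%N by rewrite leq_mul2r k_gt1 orbT.
move: card_leq_d; lia.
Qed.

Let diff_pow : {in S & opp_A, forall s a, (s - a) ^+ d = 1}.
Proof.
move=> s _ sS /imsetP[a aA ->]; rewrite opprK addrC; apply: kth_powers_exp.
by rewrite decomposition imset2_f.
Qed.

Let opp_A_gt0 : (0 < #|opp_A|)%N.
Proof. by rewrite card_opp_A card_gt0; have [] := summands_neq0. Qed.

Lemma decomposition_card : (#|A| * #|S| = d)%N.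
Proof.
apply/eqP; rewrite eqn_leq -{2}card_kth_powers decomposition card_sumset_leq andbT.
rewrite -card_opp_A; exact: hanson_petridis opp_A_gt0 d_gt0 fact_neq0 diff_pow.
Qed.

(** It remains to see that the factor in [extremal_card_leq] is nonzero modulo [p]. The negated
    conclusion makes [d], and so [p], large enough compared with [n]. *)
Lemma decomposition_card_leq : (2 < #|A|)%N -> (#|S| <= 2 * #|A|.-1)%N.
Proof.
move=> A2; rewrite leqNgt; apply/negP => S_gt.
have dE := decomposition_card; set n := #|A| in A2 S_gt dE.
have d2 : (2 < d)%N by rewrite -dE; apply: leq_trans A2 _; rewrite leq_pmulr //; lia.
have dE' : (#|opp_A| * #|S| = d)%N by rewrite card_opp_A.
have n_lt : (k * (n * (2 * n.-1).+1) < p)%N.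
  by rewrite [ltnRHS]pE ltnS -dE !leq_mul2l S_gt !orbT.
suff nz : (n%:R - 1) * (2 * n%:R * (n%:R + 1) + (3 * n%:R + 2) * (d%:R - 1)) != 0 :> 'F_p.
  have := extremal_card_leq opp_A_gt0 d2 fact_neq0 diff_pow dE'.
  by rewrite card_opp_A leqNgt S_gt => /(_ nz).
apply: mulf_neq0.
  rewrite -(@natrB _ n 1) ?(ltnW (ltnW A2)) //; apply: natr_Fp_neq0.
  by move: A2 n_lt k_gt1; clear; nia.
(* Multiplied by [k], the second factor is congruent to [y], because [k d = -1]
   in ['F_p]; the bound [n (2 n - 1) <= d] gives [0 < y < p]. *)
pose y := (2 * k * n * n.+1 - (3 * n + 2) * k.+1)%N.
(* Both sides equal 24 at [n = k = 2]; the strict inequality uses [n >= 3]. *)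
have y_ge : ((3 * n + 2) * k.+1 < 2 * k * n * n.+1)%N.
  by move: A2 k_gt1; clear; nia.
have kd : k%:R * d%:R = -1 :> 'F_p.
  apply/eqP; rewrite -addr_eq0 -natrM natr1 -pE; apply/eqP.
  exact: pchar_Fp_0 p_prime.
have y_neq0 : y%:R != 0 :> 'F_p.
  apply: natr_Fp_neq0; rewrite subn_gt0 y_ge /=.
  apply: leq_trans n_lt; rewrite ltnS /y.
  by move: A2 k_gt1; clear; nia.
apply: contraNneq y_neq0 => X0; rewrite /y natrB ?(ltnW y_ge) // !natrM natrD natrM.
rewrite -[n.+1%:R]natr1 -[k.+1%:R]natr1 -[X in _ == X](mulr0 k%:R) -X0.
apply/eqP; transitivity (2 * k%:R * n%:R * (n%:R + 1)
  + (3 * n%:R + 2) * (k%:R * d%:R - k%:R) : 'F_p); last by ring.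
by rewrite kd; ring.
Qed.

End Decomposition.

End PowerResidues.

(** * Decompositions into three summands *)

Section TernaryDecomposition.
Variables (k p d : nat).
Hypotheses (p_prime : prime p) (k_gt1 : 1 < k) (pE : p = (k * d).+1).
Hypothesis d_gt24 : 24 < d.
Local Notation D := (kth_powers p k).

Lemma kth_powers_neq_sumset3_sorted (A B C : {set 'F_p}) :
  1 < #|A| -> #|A| <= #|B| <= #|C| -> D <> sumset (sumset A B) C.
Proof.
move=> A1 /andP[AB BC] DE.
have A0 : A != set0 by rewrite -card_gt0 ltnW.
have C0 : C != set0 by rewrite -card_gt0 (leq_trans _ BC) ?(leq_trans _ AB) // ltnW.
have card := decomposition_card p_prime k_gt1 pE.
have card_leq := decomposition_card_leq p_prime k_gt1 pE.
have DE' : D = sumset (sumset A C) B by rewrite DE -!sumsetA (sumsetC B).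
have B0 : B != set0 by rewrite -card_gt0 (leq_trans _ AB) // ltnW.
have cardD := card_kth_powers p_prime k_gt1 pE.
have card_AB : #|sumset A B| = #|A| * #|B|.
  by apply: (card_sumset_direct C0); rewrite -DE' cardD (card _ _ DE').
have card_AC : #|sumset A C| = #|A| * #|C|.
  by apply: (card_sumset_direct B0); rewrite -DE cardD (card _ _ DE).
have [B2|B2] := ltnP 2 #|B|.
  (* This gives [#|A| * #|C| <= 2 * (#|B| - 1)], whereas the left side is at least [2 * #|B|]. *)
  have := card_leq _ _ (etrans DE' (sumsetC _ _)) B2.
  by rewrite card_AC; move: A1 AB BC B2; clear; nia.
(* With four elements in [A + B] the bound reads [#|C| <= 6], so [d = 4 * #|C| <= 24]; this is the
   origin of the constant 24. *)
have := card _ _ DE; have := card_leq _ _ DE; rewrite card_AB.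
have [-> ->] : #|A| = 2 /\ #|B| = 2 by move: A1 AB B2; clear; lia.
by move=> /(_ isT) ? ?; move: d_gt24; lia.
Qed.

End TernaryDecomposition.

Theorem theorem2 (k p : nat) (hk : 2 <= k) (hp : prime p)
    (hpk : p = 1 %[mod k]) (hlt : 217 ^ 2 * k ^ 4 < p)
    (A B C : {set 'F_p})
    (hA : 2 <= #|A|) (hB : 2 <= #|B|) (hC : 2 <= #|C|) :
  kth_powers p k <> sumset (sumset A B) C.
Proof.
have p_gt0 := prime_gt0 hp.
have /dvdnP[d pE] : k %| p - 1 by rewrite -eqn_mod_dvd //; apply/eqP.
have {}pE : p = (k * d).+1 by rewrite mulnC -pE subn1 prednK.
(* Indeed [24 * k + 1 <= 25 * k <= 217 ^ 2 * k ^ 4 < p = k * d + 1]. *)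
have d_gt24 : 24 < d.
  rewrite -(ltn_pmul2l (ltnW hk)) -ltnS -pE; apply: leq_ltn_trans hlt.
  apply: (@leq_trans (25 * k)); first by move: hk; clear; lia.
  apply: leq_mul.
    by rewrite -[25]/(5 ^ 2) leq_exp2r.
  by rewrite -{1}(expn1 k) leq_pexp2l // ltnW.
have sorted (X Y Z : {set 'F_p}) : 1 < #|X| -> #|X| <= #|Y| <= #|Z| ->
  kth_powers p k <> sumset (sumset X Y) Z.
  exact: kth_powers_neq_sumset3_sorted hp hk pE d_gt24 X Y Z.
have swap (X Y Z : {set 'F_p}) : sumset (sumset X Y) Z = sumset (sumset X Z) Y.
  by rewrite -!sumsetA (sumsetC Y).
(* Two of the eight cases are cyclic; their weak inequalities still yield a sorted order. *)
have [AB|/ltnW BA] := leqP #|A| #|B|; have [BC|/ltnW CB] := leqP #|B| #|C|;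
  have [AC|/ltnW CA] := leqP #|A| #|C|.
- by apply: sorted => //; rewrite AB.
- by apply: sorted => //; rewrite AB.
- by rewrite swap; apply: sorted => //; rewrite AC.
- by rewrite swap (sumsetC A); apply: sorted => //; rewrite CA.
- by rewrite (sumsetC A); apply: sorted => //; rewrite BA.
- by rewrite (sumsetC A) swap; apply: sorted => //; rewrite BC.
- by rewrite (sumsetC A) swap (sumsetC B); apply: sorted => //; rewrite CB.
- by rewrite (sumsetC A) swap (sumsetC B); apply: sorted => //; rewrite CB.
Qed.
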